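(* Let $S$ and $T$ be semigroups with $[S]\cong[T]$. If either $S$ or $T$ is globally idempotent and weakly reductive, then $S\cong T$.
   Context: For a semigroup $S$, $[S]$ denotes the set $S$ with its natural ternary operation $[abc]=(ab)c$. $[S]\cong[T]$ means that there is a bijection $\delta:S\to T$ with $\delta[abc]=[(\delta a)(\delta b)(\delta c)]$ for all $a,b,c\in S$. A semigroup $S$ is globally idempotent if $S=S^2$ (every element is a product of two elements of $S$). It is weakly reductive if for all $x,y\in S$: if $xz=yz$ and $zx=zy$ for all $z\in S$, then $x=y$. *)

(* Defs.v *)
From mathcomp Require Import all_boot.

Set Implicit Arguments.
Unset Strict Implicit.
Unset Printing Implicit Defensive.

Local Open Scope group_scope.

(* The library's [semigroupType] also carries a choice structure, hence a
   decidable equality, which is not part of the notion of a semigroup.  A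
   semigroup on an arbitrary carrier is a [magmaType] satisfying this. *)
Definition is_semigroup (S : magmaType) : Prop :=
  associative (fun x y : S => x * y).

Definition tmul (S : magmaType) (a b c : S) : S := (a * b) * c.

Definition ternary_isomorphic (S T : magmaType) : Prop :=
  exists2 d : S -> T, bijective d &
    forall a b c : S, d (tmul a b c) = tmul (d a) (d b) (d c).

Definition isomorphic (S T : magmaType) : Prop :=
  exists f : {multiplicative S -> T}, bijective f.

Definition globally_idempotent (S : magmaType) : Prop :=
  forall x : S, exists a b : S, x = a * b.

Definition weakly_reductive (S : magmaType) : Prop :=
  forall x y : S, (forall z : S, x * z = y * z /\ z * x = z * y) -> x = y.

(* Main.v *)
(* If d : S -> T is an isomorphism of ternary semigroups, then d a * d b depends
   only on a * b: both d a * d b * d z = d (a * b * z) and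
   d z * (d a * d b) = d (z * a * b) do, and T is weakly reductive.  As S = S^2,
   the rule a * b |-> d a * d b defines a map S -> T; it is multiplicative since
   d (a * b * c) * d e = (d a * d b) * (d c * d e), and the same construction
   applied to the inverse of d inverts it.  Both hypotheses depend only on the
   ternary operation, so they hold in S as soon as they hold in T and conversely. *)
Require Import Defs.
From HB Require Import structures.
From mathcomp Require Import all_boot.
From Stdlib Require Import IndefiniteDescription.

Set Implicit Arguments.
Unset Strict Implicit.
Unset Printing Implicit Defensive.

Local Open Scope group_scope.

Definition ternary_morphism (S T : magmaType) (d : S -> T) : Prop :=
  forall a b c : S, d (a * b * c) = d a * d b * d c.

Lemma can_ternary_morphism (S T : magmaType) (d : S -> T) (e : T -> S) :
  cancel d e -> cancel e d -> ternary_morphism d -> ternary_morphism e.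
Proof. by move=> dK eK dM a b c; rewrite -{1}[a]eK -{1}[b]eK -{1}[c]eK -dM dK. Qed.

(** Factoring twice writes [e y] as a triple product, which [d] carries to a triple product equal to
    [y]. *)
Lemma ternary_globally_idempotent (S T : magmaType) (d : S -> T) (e : T -> S) :
    cancel e d -> ternary_morphism d ->
  globally_idempotent S -> globally_idempotent T.
Proof.
move=> eK dM gi y; have [a [c yE]] := gi (e y); have [a1 [a2 aE]] := gi a.
by exists (d a1 * d a2), (d c); rewrite -[LHS]eK yE aE dM.
Qed.

Lemma ternary_weakly_reductive (S T : magmaType) (d : S -> T) (e : T -> S) :
    is_semigroup S -> is_semigroup T ->
    cancel d e -> cancel e d -> ternary_morphism d ->
    globally_idempotent S -> weakly_reductive S ->
  weakly_reductive T.
Proof.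
move=> mulSA mulTA dK eK dM gi wr x y xy.
(* Splitting [z] as [u * v] turns the binary products with [e x] and [e y] into ternary ones, which
   [d] respects. *)
apply: (can_inj eK); apply: wr => z; have [u [v ->]] := gi z.
split; apply: (can_inj dK).
  by rewrite !mulSA !dM !eK (xy (d u)).1.
by rewrite !dM !eK -!mulTA !(xy (d v)).2.
Qed.

Lemma ternary_mul_eq (S T : magmaType) (d : S -> T) (e : T -> S) :
    is_semigroup S -> is_semigroup T ->
    cancel e d -> ternary_morphism d -> weakly_reductive T ->
  forall a b a' b' : S, a * b = a' * b' -> d a * d b = d a' * d b'.
Proof.
move=> mulSA mulTA eK dM wr a b a' b' ab; apply: wr => z; rewrite -[z]eK.
by split; [rewrite -!dM ab | rewrite !mulTA -!dM -!mulSA ab].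
Qed.

Lemma ternary_isomorphic_isomorphic (S T : magmaType) (d : S -> T) (e : T -> S) :
    is_semigroup S -> is_semigroup T ->
    cancel d e -> cancel e d -> ternary_morphism d ->
    globally_idempotent S -> weakly_reductive S ->
    globally_idempotent T -> weakly_reductive T ->
  isomorphic S T.
Proof.
move=> mulSA mulTA dK eK dM giS wrS giT wrT.
have eM := can_ternary_morphism dK eK dM.
have dmul_eq := ternary_mul_eq mulSA mulTA eK dM wrT.
have emul_eq := ternary_mul_eq mulTA mulSA dK eM wrS.
(* Graph of the rule a * b |-> d a * d b; choice in each direction gives [f] and its inverse [g]. *)
pose R x y := exists a b, x = a * b /\ y = d a * d b.
have [f fR] : exists f, forall x, R x (f x).
  apply: functional_choice => x; have [a [b ->]] := giS x.
  by exists (d a * d b), a, b.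
have [g gR] : exists g, forall y, R (g y) y.
  apply: (functional_choice (fun y x => R x y)) => y; have [u [v ->]] := giT y.
  by exists (e u * e v), (e u), (e v); rewrite !eK.
have fE a b : f (a * b) = d a * d b.
  by have [a' [b' [ab ->]]] := fR (a * b); apply: dmul_eq.
have fM : {morph f : x y / x * y}.
  move=> x y; have [a [b ->]] := giS x; have [a' [b' ->]] := giS y.
  by rewrite mulSA !fE dM mulTA.
have fK : cancel f g.
  move=> x; have [a [b [-> fx]]] := gR (f x).
  have [a' [b' xE]] := giS x; move: fx; rewrite xE fE => ab.
  (* The two factorizations have equal images under the rule; well-definedness of the rule for [e],
     taken at the [d]-images, brings this back to [S]. *)
  by rewrite -[a]dK -[b]dK -[a']dK -[b']dK; apply: emul_eq.
have gK : cancel g f.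
  by move=> y; have [a [b [-> yE]]] := gR y; rewrite fE.
pose fmul := isMultiplicative.Build S T f fM.
pose F : {multiplicative S -> T} := HB.pack f fmul.
by exists F; exists g.
Qed.

Theorem corollary13 (S T : magmaType)
    (hS : is_semigroup S) (hT : is_semigroup T)
    (hST : ternary_isomorphic S T)
    (hgw : (globally_idempotent S /\ weakly_reductive S) \/
           (globally_idempotent T /\ weakly_reductive T)) :
  isomorphic S T.
Proof.
have [d [e dK eK] dM] := hST; have eM := can_ternary_morphism dK eK dM.
have [[giS wrS] [giT wrT]] : (globally_idempotent S /\ weakly_reductive S) /\
    (globally_idempotent T /\ weakly_reductive T).
  have [[gi wr]|[gi wr]] := hgw; split; split=> //.
  - exact: ternary_globally_idempotent eK dM gi.
  - exact: ternary_weakly_reductive hS hT dK eK dM gi wr.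
  - exact: ternary_globally_idempotent dK eM gi.
  - exact: ternary_weakly_reductive hT hS eK dK eM gi wr.
exact: ternary_isomorphic_isomorphic dK eK dM giS wrS giT wrT.
Qed.
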